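(* Let $n\ge 1$, let $\mathbb{G}^n$ be the step two nilpotent Lie group with elements $g=(t_1,\ldots,t_n;p;q_1,\ldots,q_n)\in\mathbb{R}^{2n+1}$, and let $f_g=\rho_gf_0$, $g\in\mathbb{G}^n$, be the coherent states generated from the vacuum vector $f_0(x)=(e^{-x^2/2},\ldots,e^{-x^2/2})$ by the representation $\rho$ described in the context. Write $f_{g,j}$ for the $j$-th component of $f_g$. For each $g'\in\mathbb{G}^n$ let $\mathcal{W}f_{g'}:\mathbb{G}^n\to\mathcal{C}\ell(n)$ be the wavelet transform of $f_{g'}$, $$\mathcal{W}f_{g'}(g)=\int_{\mathbb{R}}\sum_{j=1}^n f_{g',j}(x)\,\overline{f_{g,j}(x)}\,dx .$$ Then for every $g'\in\mathbb{G}^n$ the function $F=\mathcal{W}f_{g'}$ is monogenic on $\mathbb{G}^n$ with respect to the Dirac operator $$D=\frac{\partial}{\partial p}-\sum_{j=1}^n e_j\frac{\partial}{\partial q_j}+\frac12\sum_{j=1}^n(e_jp+q_j)\frac{\partial}{\partial t_j},$$ that is, $DF=0$ identically on $\mathbb{G}^n$.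
   Context: $\mathcal{C}\ell(n)$ is the real Clifford algebra generated by $1,e_1,\ldots,e_n$ with $e_ie_j+e_je_i=-2\delta_{ij}$ for $1\le i,j\le n$. In particular $e_j^2=-1$, so $\mathrm{span}_{\mathbb{R}}\{1,e_j\}$ is a copy of $\mathbb{C}$ inside $\mathcal{C}\ell(n)$; for $u=u'+u''e_j$ with $u',u''\in\mathbb{R}$ write $\bar u=u'-u''e_j$, and $e^{e_j\theta}=\cos\theta+e_j\sin\theta$ for $\theta\in\mathbb{R}$. Clifford coefficients of differential operators act by left multiplication on $\mathcal{C}\ell(n)$-valued functions. The group $\mathbb{G}^n$ is $\mathbb{R}^{2n+1}$ with elements $(t_1,\ldots,t_n;p;q_1,\ldots,q_n)$ and group law $$(t_1,\ldots,t_n;p;q_1,\ldots,q_n)*(t_1',\ldots,t_n';p';q_1',\ldots,q_n')=\left(t_1+t_1'+\tfrac12(p'q_1-pq_1'),\ldots,t_n+t_n'+\tfrac12(p'q_n-pq_n');\ p+p';\ q_1+q_1',\ldots,q_n+q_n'\right).$$ It acts on functions $f=(f_1,\ldots,f_n)$ on $\mathbb{R}$, where $f_j$ takes values in $\mathrm{span}_{\mathbb{R}}\{1,e_j\}$, by the representation $$[\rho_gf](x)=\left(e^{e_1(2t_1+q_1(\sqrt2x-p))}f_1(x-\sqrt2p),\ \ldots,\ e^{e_n(2t_n+q_n(\sqrt2x-p))}f_n(x-\sqrt2p)\right),\quad g=(t_1,\ldots,t_n;p;q_1,\ldots,q_n).$$ Thus the $j$-th component of the coherent state $f_g=\rho_gf_0$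 is $f_{g,j}(x)=e^{e_j(2t_j+q_j(\sqrt2x-p))}e^{-(x-\sqrt2p)^2/2}$. *)

(* Defs.v *)
From HB Require Import structures.
From mathcomp Require Import all_boot all_order all_algebra.
From mathcomp Require Import ring.

Set Implicit Arguments.
Unset Strict Implicit.
Unset Printing Implicit Defensive.

Import Order.TTheory GRing.Theory Num.Theory.

Local Open Scope ring_scope.

Section SymmetricDifference.
Variable T : finType.
Implicit Types A B C : {set T}.

Definition symd A B : {set T} := (A :\: B) :|: (B :\: A).

Lemma in_symd A B x : (x \in symd A B) = (x \in A) (+) (x \in B).
Proof. by rewrite !inE; case: (x \in A); case: (x \in B). Qed.

Lemma symdA : associative symd.
Proof. by move=> A B C; apply/setP => x; rewrite !in_symd addbA. Qed.

Lemma symd0 A : symd A set0 = A.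
Proof. by apply/setP => x; rewrite in_symd inE addbF. Qed.

Lemma sym0d A : symd set0 A = A.
Proof. by apply/setP => x; rewrite in_symd inE addFb. Qed.

Lemma symdd A : symd A A = set0.
Proof. by apply/setP => x; rewrite in_symd inE addbb. Qed.

Lemma symdK A B : symd A (symd A B) = B.
Proof. by rewrite symdA symdd sym0d. Qed.

Lemma symd_eq A B C : (symd A B == C) = (B == symd A C).
Proof. by apply/eqP/eqP => [<-|->]; rewrite symdK. Qed.

Lemma prod_symd (R : comNzRingType) (F : T -> R) A B :
  (forall x, F x * F x = 1) ->
  \prod_(x in symd A B) F x = (\prod_(x in A) F x) * \prod_(x in B) F x.
Proof.
move=> F2; rewrite big_mkcond [X in _ = X * _]big_mkcond [X in _ = _ * X]big_mkcond.
rewrite -big_split /=; apply: eq_bigr => x _.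
by rewrite in_symd; case: (x \in A); case: (x \in B);
  rewrite /= ?mulr1 ?mul1r ?F2.
Qed.

End SymmetricDifference.

(* The Clifford algebra on generators e_0, ..., e_(n-1) with
   e_i e_j + e_j e_i = - 2 delta_ij.  An element is the family of its
   coordinates in the basis e_A = e_(a1) ... e_(ak),
   A = {a1 < ... < ak}.  Moving the factors of e_B one by one through e_A gives
   e_A e_B = (-1)^(number of (i, j) in A x B with j <= i) e_(A symd B), the
   pairs with j = i accounting for e_i ^ 2 = -1. *)
Definition clifford (R : comNzRingType) (n : nat) := {ffun {set 'I_n} -> R}.

Section CliffordAlgebra.
Variables (R : comNzRingType) (n : nat).
Local Notation Cl := (clifford R n).
Implicit Types (u v w : Cl) (A B C : {set 'I_n}).

HB.instance Definition _ := GRing.Lmodule.copy Cl {ffun {set 'I_n} -> R^o}.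

Definition cl_sign A B : R := (-1) ^+ (\sum_(i in A) #|[set j in B | j <= i]|)%N.

Definition cl_basis A : Cl := [ffun B => (B == A)%:R].

Definition cl_mul u v : Cl :=
  [ffun C => \sum_A \sum_(B | symd A B == C) cl_sign A B * (u A * v B)].

Let s (i j : 'I_n) : R := if (j <= i)%N then -1 else 1.

Let ss i j : s i j * s i j = 1.
Proof. by rewrite /s; case: ifP => _; rewrite ?mulrNN mulr1. Qed.

Lemma cl_signE A B : cl_sign A B = \prod_(i in A) \prod_(j in B) s i j.
Proof.
rewrite /cl_sign -prodrXr; apply: eq_bigr => i _.
rewrite /s -big_mkcondr /= -prodr_const.
by apply: eq_bigl => j; rewrite inE.
Qed.

Lemma cl_sign_symdl A B C :
  cl_sign (symd A B) C = cl_sign A C * cl_sign B C.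
Proof.
rewrite !cl_signE prod_symd// => i.
by rewrite -big_split /= big1// => j _; rewrite ss.
Qed.

Lemma cl_sign_symdr A B C :
  cl_sign A (symd B C) = cl_sign A B * cl_sign A C.
Proof.
rewrite !cl_signE -big_split; apply: eq_bigr => i _.
by rewrite prod_symd// => j; rewrite ss.
Qed.

Lemma cl_sign0l A : cl_sign set0 A = 1.
Proof. by rewrite cl_signE big_set0. Qed.

Lemma cl_sign0r A : cl_sign A set0 = 1.
Proof. by rewrite cl_signE big1// => i _; rewrite big_set0. Qed.

Lemma cl_mulE u v C : cl_mul u v C =
  \sum_A cl_sign A (symd A C) * (u A * v (symd A C)).
Proof.
rewrite ffunE; apply: eq_bigr => A _.
by under eq_bigl do rewrite symd_eq; rewrite big_pred1_eq.
Qed.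

Let cl_mulA : associative cl_mul.
Proof.
move=> u v w; apply/ffunP => D; rewrite !cl_mulE.
under eq_bigr do rewrite cl_mulE mulr_sumr mulr_sumr.
under [RHS]eq_bigr do rewrite cl_mulE mulr_suml mulr_sumr.
rewrite [RHS]exchange_big /=; apply: eq_bigr => A _.
rewrite (reindex_inj (can_inj (@symdK _ A))) /=; apply: eq_bigr => C _.
have -> : symd (symd A C) (symd A D) = symd C D.
  apply/setP => x; rewrite !in_symd.
  by case: (x \in A); case: (x \in C); case: (x \in D).
have -> : cl_sign A (symd A D) = cl_sign A (symd A C) * cl_sign A (symd C D).
  by rewrite -cl_sign_symdr -symdA symdK.
have -> : cl_sign C (symd C D) =
    cl_sign A (symd C D) * cl_sign (symd A C) (symd C D).
  by rewrite -cl_sign_symdl symdK.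
ring.
Qed.

Let cl_mul1l : left_id (cl_basis set0) cl_mul.
Proof.
move=> u; apply/ffunP => C; rewrite cl_mulE (bigD1 set0)//= ffunE eqxx.
rewrite sym0d cl_sign0l !mul1r big1 ?addr0// => A /negbTE A0.
by rewrite ffunE A0 mul0r mulr0.
Qed.

Let cl_mul1r : right_id (cl_basis set0) cl_mul.
Proof.
move=> u; apply/ffunP => C; rewrite cl_mulE (bigD1 C)//= ffunE symdd eqxx.
rewrite cl_sign0r mul1r mulr1 big1 ?addr0// => A AC.
rewrite ffunE symd_eq symd0 eq_sym (negbTE AC).
by rewrite mulr0 mulr0.
Qed.

Let cl_mulDl : left_distributive cl_mul +%R.
Proof.
move=> u v w; apply/ffunP => C; rewrite [RHS]ffunE !cl_mulE -big_split.
by apply: eq_bigr => A _; rewrite ffunE mulrDl mulrDr.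
Qed.

Let cl_mulDr : right_distributive cl_mul +%R.
Proof.
move=> u v w; apply/ffunP => C; rewrite [RHS]ffunE !cl_mulE -big_split.
by apply: eq_bigr => A _; rewrite ffunE mulrDr mulrDr.
Qed.

Let cl_1neq0 : cl_basis set0 != 0.
Proof. by apply/eqP => /ffunP/(_ set0)/eqP; rewrite !ffunE eqxx oner_eq0. Qed.

HB.instance Definition _ := GRing.Zmodule_isNzRing.Build Cl
  cl_mulA cl_mul1l cl_mul1r cl_mulDl cl_mulDr cl_1neq0.

Lemma cl_scaleE (a : R) u C : (a *: u) C = a * u C.
Proof. by rewrite ffunE. Qed.

Let cl_scalerAl (a : R) u v : a *: (u * v) = (a *: u) * v.
Proof.
apply/ffunP => C; rewrite cl_scaleE !cl_mulE mulr_sumr; apply: eq_bigr => A _.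
by rewrite cl_scaleE; ring.
Qed.

HB.instance Definition _ := GRing.Lmodule_isLalgebra.Build R Cl cl_scalerAl.

Let cl_scalerAr (a : R) u v : a *: (u * v) = u * (a *: v).
Proof.
apply/ffunP => C; rewrite cl_scaleE !cl_mulE mulr_sumr; apply: eq_bigr => A _.
by rewrite cl_scaleE; ring.
Qed.

HB.instance Definition _ := GRing.Lalgebra_isAlgebra.Build R Cl cl_scalerAr.

Definition cl_gen (j : 'I_n) : Cl := cl_basis [set j].

Lemma cl_basisM A B :
  cl_basis A * cl_basis B = cl_sign A B *: cl_basis (symd A B).
Proof.
apply/ffunP => C; rewrite cl_mulE (bigD1 A)//= big1 ?addr0; last first.
  by move=> D /negbTE DA; rewrite ffunE DA mul0r mulr0.
rewrite cl_scaleE !ffunE eqxx mul1r symd_eq.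
by case: eqP => [->|_]; rewrite ?symdK ?mulr0.
Qed.

Lemma cl_sign1 (i j : 'I_n) :
  cl_sign [set i] [set j] = if (j <= i)%N then -1 else 1.
Proof. by rewrite cl_signE !big_set1. Qed.

Lemma cl_genM (i j : 'I_n) :
  cl_gen i * cl_gen j + cl_gen j * cl_gen i = - (2 * (i == j)%:R)%:A.
Proof.
rewrite /cl_gen !cl_basisM !cl_sign1.
have -> : symd [set j] [set i] = symd [set i] [set j].
  by apply/setP => x; rewrite !in_symd addbC.
rewrite -scalerDl; case: (ltngtP i j) => [ij|ij|/val_inj ->].
- by rewrite -val_eqE (ltn_eqF ij) mulr0 subrr !scale0r oppr0.
- by rewrite -val_eqE eq_sym (ltn_eqF ij) mulr0 addNr !scale0r oppr0.
by rewrite eqxx mulr1 symdd -scaleNr opprD.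
Qed.

Lemma cl_basis_prod A : cl_basis A = \prod_(i <- enum A) cl_gen i.
Proof.
have : sorted (fun i j : 'I_n => (i < j)%N) (enum A).
  rewrite /enum_mem; apply: sorted_filter; first by move=> y x z; exact: ltn_trans.
  rewrite -enumT; have := iota_ltn_sorted 0 n.
  by rewrite -val_enum_ord sorted_map.
rewrite -{2}[A]set_enum; elim: (enum A) => [|i l IH] /= il.
  by rewrite big_nil set_nil.
rewrite big_cons -IH ?(path_sorted il)// cl_basisM.
have /allP lti : all (fun j : 'I_n => (i < j)%N) l.
  by apply: order_path_min il => x y z; exact: ltn_trans.
have -> : cl_sign [set i] [set j in l] = 1.
  rewrite cl_signE big_set1 big1// => j; rewrite inE => /lti.
  by rewrite /s ltnNge => /negbTE ->.
rewrite scale1r; congr cl_basis; apply/setP => x; rewrite in_symd !inE.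
case: eqP => //= ->; case: (boolP (i \in l)) => // /lti.
by rewrite ltnn.
Qed.

(* Conjugation u' + u'' e_j |-> u' - u'' e_j; only meaningful on
   span{1, e_j}. *)
Definition cl_conj (j : 'I_n) u : Cl :=
  (u set0)%:A - u [set j] *: cl_gen j.

Definition in_span1 (j : 'I_n) u := exists a b : R, u = a%:A + b *: cl_gen j.

Lemma cl_conjE (j : 'I_n) (a b : R) :
  cl_conj j (a%:A + b *: cl_gen j) = a%:A - b *: cl_gen j.
Proof.
have j0 : (set0 == [set j]) = false.
  by apply/eqP => /setP/(_ j); rewrite !inE eqxx.
rewrite /cl_conj !(cl_scaleE, ffunE) eqxx j0 [_ == set0]eq_sym j0 eqxx.
by rewrite !(mulr0, mulr1, addr0, add0r).
Qed.

Lemma cl_gen_sqr (j : 'I_n) : cl_gen j * cl_gen j = -1.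
Proof.
by rewrite /cl_gen cl_basisM cl_sign1 leqnn symdd scaleN1r.
Qed.

End CliffordAlgebra.

From mathcomp Require Import all_classical all_reals all_analysis.
Import numFieldNormedType.Exports.
Local Open Scope ring_scope.

Section NilpotentGroup.
Variables (R : realType) (n : nat).

(* (t, p, q) in R^n x R x R^n *)
Definition Gn : Type := 'rV[R]_n * R * 'rV[R]_n.

HB.instance Definition _ := NormedModule.copy Gn ('rV[R]_n * R * 'rV[R]_n)%type.

Implicit Types g h : Gn.

Definition tco g (j : 'I_n) : R := g.1.1 ord0 j.
Definition pco g : R := g.1.2.
Definition qco g (j : 'I_n) : R := g.2 ord0 j.

Definition gn_mul g h : Gn :=
  (g.1.1 + h.1.1 + 2^-1 *: (pco h *: g.2 - pco g *: h.2),
   pco g + pco h, g.2 + h.2).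

Definition gn_one : Gn := (0, 0, 0).

Definition gn_inv g : Gn := (- g.1.1, - g.1.2, - g.2).

Let gn_ext g h : (forall j, tco g j = tco h j) -> pco g = pco h ->
  (forall j, qco g j = qco h j) -> g = h.
Proof.
case: g h => [[t p] q] [[t' p'] q'] /= ht hp hq; congr (_, _, _) => //.
  by apply/rowP => j; exact: ht.
by apply/rowP => j; exact: hq.
Qed.

Lemma tcoM g h j : tco (gn_mul g h) j =
  tco g j + tco h j + 2^-1 * (pco h * qco g j - pco g * qco h j).
Proof. by rewrite /tco /= !mxE. Qed.

Lemma qcoM g h j : qco (gn_mul g h) j = qco g j + qco h j.
Proof. by rewrite /qco /= !mxE. Qed.

Let gn_mulA : associative gn_mul.
Proof.
move=> g h k; apply: gn_ext => [j||j].
- by rewrite !tcoM !qcoM /pco/=; ring.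
- exact: addrA.
- by rewrite !qcoM addrA.
Qed.

Let gn_mul1g : left_id gn_one gn_mul.
Proof.
move=> g; apply: gn_ext => [j||j].
- by rewrite tcoM /tco/qco/pco /= !mxE; ring.
- exact: add0r.
- by rewrite qcoM /qco /= mxE add0r.
Qed.

Let gn_mulg1 : right_id gn_one gn_mul.
Proof.
move=> g; apply: gn_ext => [j||j].
- by rewrite tcoM /tco/qco/pco /= !mxE; ring.
- exact: addr0.
- by rewrite qcoM /qco /= mxE addr0.
Qed.

Let gn_mulVg : left_inverse gn_one gn_inv gn_mul.
Proof.
move=> g; apply: gn_ext => [j||j].
- by rewrite tcoM /tco/qco/pco /= !mxE; ring.
- exact: addNr.
- by rewrite qcoM /qco /= !mxE addNr.
Qed.

Let gn_mulgV : right_inverse gn_one gn_inv gn_mul.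
Proof.
move=> g; apply: gn_ext => [j||j].
- by rewrite tcoM /tco/qco/pco /= !mxE; ring.
- exact: addrN.
- by rewrite qcoM /qco /= !mxE addrN.
Qed.

HB.instance Definition _ := isGroup.Build Gn
  gn_mulA gn_mul1g gn_mulg1 gn_mulVg gn_mulgV.

Definition dir_t (j : 'I_n) : Gn := (delta_mx 0 j, 0, 0).
Definition dir_p : Gn := (0, 1, 0).
Definition dir_q (j : 'I_n) : Gn := (0, 0, delta_mx 0 j).

End NilpotentGroup.

Section CoherentStates.
Variables (R : realType) (n : nat).
Local Notation Cl := (clifford R n).
Local Notation G := (Gn R n).
Local Notation mu := (@lebesgue_measure R).
Implicit Types (g h : G) (f : 'I_n -> R -> Cl) (F : G -> Cl) (j : 'I_n).

Definition cl_expi j (theta : R) : Cl :=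
  (cos theta)%:A + sin theta *: cl_gen R j.

(* The representation space consists of the f with f j x in span{1, e_j}; it is
   stable under rho (rho_span below). *)
Definition rho g f : 'I_n -> R -> Cl := fun j x =>
  cl_expi j (2 * tco g j + qco g j * (Num.sqrt 2 * x - pco g)) *
  f j (x - Num.sqrt 2 * pco g).

Lemma cl_expiD j (a b : R) : cl_expi j (a + b) = cl_expi j a * cl_expi j b.
Proof.
rewrite /cl_expi cosD sinD mulrDl !mulrDr -!scalerAl !mul1r.
rewrite -!scalerAr !mulr1 cl_gen_sqr !scalerA scalerBl scalerDl scalerN.
rewrite [in RHS]addrACA [in RHS]addrA -!addrA; congr (_ + _).
by rewrite addrC -addrA.
Qed.

Lemma rho_mul g h f : rho (g * h)%g f = rho g (rho h f).
Proof.
apply/funext => j; apply/funext => x; rewrite /rho mulrA -cl_expiD.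
rewrite [tco (g * h)%g j]tcoM [qco (g * h)%g j]qcoM.
have -> : pco (g * h)%g = pco g + pco h by [].
have sqrt22 : Num.sqrt 2 * Num.sqrt 2 = 2 :> R by rewrite -expr2 sqr_sqrtr.
congr (cl_expi _ _ * f j _); last by ring.
rewrite (_ : _ * (x - _) = Num.sqrt 2 * x - 2 * pco g); first by field.
by rewrite mulrBr mulrA sqrt22.
Qed.

Lemma rho_span g f : (forall j x, in_span1 j (f j x)) ->
  forall j x, in_span1 j (rho g f j x).
Proof.
move=> fspan j x; rewrite /rho /cl_expi.
set c := cos _; set d := sin _.
have [a [b ->]] := fspan j (x - Num.sqrt 2 * pco g).
exists (c * a - d * b), (c * b + d * a).
rewrite mulrDl !mulrDr -!scalerAl !mul1r -!scalerAr !mulr1 cl_gen_sqr.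
rewrite !scalerA scalerBl scalerDl scalerN.
rewrite -!addrA; congr (_ + _).
by rewrite [RHS]addrC -addrA.
Qed.

Definition vacuum : 'I_n -> R -> Cl := fun _ x => (expR (- (x ^+ 2 / 2)))%:A.

Definition coherent g : 'I_n -> R -> Cl := rho g vacuum.

(* Integrals and directional derivatives of Clifford-valued functions are taken
   coordinatewise in the basis e_A.  The Lebesgue integral is total; the
   integrand in wavelet (coherent g') g is dominated by a Gaussian. *)
Definition cl_integral (u : R -> Cl) : Cl :=
  [ffun A => (\int[mu]_(x in setT) u x A)%R].

Definition wavelet f g : Cl :=
  cl_integral (fun x => \sum_(j < n) f j x * cl_conj j (coherent g j x)).

Definition cl_differentiable F g := forall A, differentiable (fun h => F h A) g.

Definition cl_derive F (v g : G) : Cl := [ffun A => 'D_v (fun h => F h A) g].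

Definition dirac F g : Cl :=
  cl_derive F (dir_p R n) g
  - \sum_(j < n) cl_gen R j * cl_derive F (dir_q R j) g
  + 2^-1 *: \sum_(j < n)
      (pco g *: cl_gen R j + (qco g j)%:A) * cl_derive F (dir_t R j) g.

(* 'D_v is total, so dirac F g is only meaningful where F is differentiable;
   hence the first clause. *)
Definition monogenic F :=
  (forall g, cl_differentiable F g) /\ (forall g, dirac F g = 0).

End CoherentStates.

(* Main.v *)
From HB Require Import structures.
Require Import Defs.
From mathcomp Require Import all_boot all_order all_algebra.
From mathcomp Require Import all_classical all_reals all_analysis.
From mathcomp Require Import measurable_realfun gauss_integral.
From mathcomp Require Import ring lra.

(* The wavelet transform has a closed form.  Completing the square and
   translating x reduces the j-th summand of W f_h (g), with h = (t', p', q') and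
   g = (t, p, q), to the Fourier transform of exp (- x ^ 2), and one finds
     W f_h (g) = sum_j sqrt pi * exp E_j * exp (e_j Theta_j),
     E_j = - ((p' - p) ^ 2 + (q'_j - q_j) ^ 2) / 2,
     Theta_j = 2 (t'_j - t_j) + q'_j p - q_j p'.
   The transform K b of exp (- x ^ 2) is sqrt pi * exp (- b ^ 2 / 4), because
   differentiating under the integral and integrating by parts give
   K' b = - (b / 2) K b.  As the j-th summand does not depend on t_k, q_k for
   k != j, and all its derivatives are its products on the left with elements of
   span {1, e_j}, the equation D (W f_h) = 0 reduces to an identity in that
   commutative plane for each j. *)

Set Implicit Arguments.
Unset Strict Implicit.
Unset Printing Implicit Defensive.

Import Order.TTheory GRing.Theory Num.Theory.
Import numFieldNormedType.Exports.
Local Open Scope ring_scope.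

(** * Integrals over the real line *)

Local Open Scope classical_set_scope.

Section RintegralSum.
Context d (T : measurableType d) (R : realType) (mu : {measure set T -> \bar R}).

Lemma Rintegral_sum (I : Type) (s : seq I) (D : set T) (f : I -> T -> R) :
  measurable D -> (forall i, mu.-integrable D (EFin \o f i)) ->
  \int[mu]_(x in D) (\sum_(i <- s) f i x) = \sum_(i <- s) \int[mu]_(x in D) f i x.
Proof.
move=> mD fi; rewrite /Rintegral.
under eq_integral do rewrite -sumEFin.
rewrite integral_sum// -sum_fine// => i _.
exact: (integrable_fin_num mD (fi i)).
Qed.

End RintegralSum.

Section RealIntegrals.
Context {R : realType}.
Local Notation mu := (@lebesgue_measure R).

(** The preimage of []a, b]] is []a - c, b - c]], which has the same length, and Lebesgue measure is
    the only measure with these values on such intervals. *)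
Lemma lebesgue_measure_shift (c : R) (A : set R) : measurable A ->
  pushforward mu ((fun x : R => x + c) : _ -> measurableTypeR R) A = mu A.
Proof.
move=> mA; apply/esym/lebesgue_measure_unique => //= [|mf _ [[a b]] _ <-].
  exact: measurable_funD.
rewrite /pushforward (_ : _ @^-1` _ = `]a - c, b - c]%classic).
  by rewrite !lebesgue_measure_itv/= !lte_fin ltrD2r -!EFinD opprB addrA subrK.
by apply/seteqP; split => x/=; rewrite !in_itv/= ltrBlDr lerBrDr.
Qed.

(** Stated for any measure-preserving map, so as to serve both the translations and the reflection
    [x |-> - x]. The change of variables for the nonnegative function [|f|] gives finiteness. *)
Lemma integrable_measure_preserving (phi f : R -> R) :
  measurable_fun setT phi ->
  (forall A, measurable A ->
    pushforward mu (phi : _ -> measurableTypeR R) A = mu A) ->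
  mu.-integrable setT (EFin \o f) ->
  mu.-integrable setT (EFin \o (f \o phi)).
Proof.
move=> mphi pmu /integrableP[/measurable_EFinP mf fi]; apply/integrableP; split.
  by apply/measurable_EFinP; exact: measurableT_comp.
rewrite (le_lt_trans _ fi)//.
have := @ge0_integral_pushforward _ _ (measurableTypeR R) (measurableTypeR R) R phi
  mphi lebesgue_measure setT (fun x => `|(f x)%:E|%E).
rewrite preimage_setT => <- //.
- rewrite le_eqVlt; apply/orP; left; apply/eqP.
  by apply: eq_measure_integral => A mA _; exact: pmu.
- by apply: measurableT_comp => //; exact/measurable_EFinP.
Qed.

Lemma Rintegral_measure_preserving (phi f : R -> R) :
  measurable_fun setT phi ->
  (forall A, measurable A ->
    pushforward mu (phi : _ -> measurableTypeR R) A = mu A) ->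
  mu.-integrable setT (EFin \o f) ->
  \int[mu]_x f (phi x) = \int[mu]_x f x.
Proof.
move=> mphi pmu fi; rewrite /Rintegral; congr fine.
have := @integral_pushforward _ _ (measurableTypeR R) (measurableTypeR R) R phi
  mphi lebesgue_measure setT (EFin \o f).
rewrite preimage_setT => <- //.
- by apply: eq_measure_integral => A mA _; exact: pmu.
- by have /integrableP[] := fi.
- exact: integrable_measure_preserving.
Qed.

(** Up to the factor [normal_peak 1] this is the normal density of mean 0 and deviation 1. *)
Lemma integrable_expR_half :
  mu.-integrable setT (fun x : R => (expR (- (x ^+ 2 / 2)))%:E).
Proof.
have := @integrable_normal_pdf R 0 1.
have n0 := @normal_peak_gt0 R 1 (oner_neq0 _).
move/(integrableZl measurableT (normal_peak 1)^-1).
apply: eq_integrable => //= x _.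
rewrite -EFinM normal_pdfE ?oner_eq0// mulrA mulVf ?gt_eqF// mul1r.
by rewrite /normal_fun subr0 expr1n mulNr.
Qed.

Lemma integrable_gauss_dominated (C : R) (f : R -> R) : continuous f ->
  (forall x, `|f x| <= C * expR (- (x ^+ 2 / 2))) ->
  mu.-integrable setT (EFin \o f).
Proof.
move=> cf fC; have iC := integrableZl measurableT C integrable_expR_half.
apply: (le_integrable _ _ _ iC) => //.
  by apply/measurable_EFinP; exact: continuous_measurable_fun.
by move=> x _ /=; rewrite lee_fin (le_trans (fC x))// ler_norm.
Qed.

(** The integral over a symmetric interval is a difference of boundary values, which tends to 0;
    dominated convergence, with [|f'|] as bound, passes to the whole line. *)
Lemma Rintegral_derive_eq0 (f f' : R -> R) :
  (forall x : R, is_derive x (1 : R) f (f' x)) -> continuous f' ->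
  mu.-integrable setT (EFin \o f') ->
  f n%:R @[n --> \oo] --> (0 : R) -> f (- n%:R) @[n --> \oo] --> (0 : R) ->
  \int[mu]_x f' x = 0.
Proof.
move=> df cf' if' fy fNy.
have mf' : measurable_fun setT f' by exact: continuous_measurable_fun.
(* The endpoints use [n.+1] so that the interval is nondegenerate also for [n = 0], as the
   fundamental theorem of calculus asks. *)
pose I (n : nat) : set R := `[- n.+1%:R, n.+1%:R]%classic.
have mI n : measurable (I n) by exact: measurable_itv.
have fderiv x : derivable f x 1 by apply: ex_derive.
have cf : continuous f.
  by move=> x; apply/differentiable_continuous/derivable1_diffP.
have FTC n : (\int[mu]_(x in I n) (f' x)%:E = (f n.+1%:R - f (- n.+1%:R))%:E)%E.
  rewrite EFinB; apply: continuous_FTC2.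
  - by rewrite ltrNl (lt_trans _ (ltr0Sn _ _))// oppr_lt0 ltr0Sn.
  - exact: continuous_subspaceT.
  - split => //.
    + by apply: cvg_at_right_filter; exact: cf.
    + by apply: cvg_at_left_filter; exact: cf.
  - by move=> x _; rewrite derive1E; exact: derive_val.
have mfI n : measurable_fun setT ((EFin \o f') \_ (I n)).
  apply/(measurable_restrictT _ (mI n)); apply: measurable_funTS.
  exact/measurable_EFinP.
have mf : measurable_fun setT (EFin \o f') by exact/measurable_EFinP.
have := @dominated_convergence _ _ _ mu setT measurableT
  (fun n => (EFin \o f') \_ (I n)) (EFin \o f') (fun x => `|(f' x)%:E|%E) mfI mf.
have -> : [sequence (\int[mu]_x ((EFin \o f') \_ (I n)) x)%E]_n%R =
    fun n => (f n.+1%:R - f (- n.+1%:R))%:E.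
  by apply/funext => n; rewrite -FTC integral_mkcond.
case.
(* At a fixed [x] the truncations equal [f' x] as soon as [n >= |x|]. *)
- apply/aeW => x _; apply: cvg_near_cst.
  near=> n; rewrite patchE mem_set// /I/= in_itv/= -ler_norml.
  rewrite (@le_trans _ _ n%:R)// ?ler_nat//; near: n; exact: nbhs_infty_ger.
- exact: integrable_abse.
- apply/aeW => x n _; rewrite patchE; case: ifPn => // _.
  by rewrite abse0 lee_fin.
move=> _ _ /cvg_unique lim.
rewrite /Rintegral (lim _ 0%E) ?fine0//.
apply: cvg_EFin; first exact: nearW.
rewrite -[X in _ --> X](subrr 0); apply: cvgB.
  by rewrite (cvg_shiftS (fun n => f n%:R)).
by rewrite (cvg_shiftS (fun n => f (- n%:R))).
Unshelve. all: end_near. Qed.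

End RealIntegrals.

(** * The Fourier transform of the Gaussian *)

Section GaussFourier.
Context {R : realType}.
Local Notation mu := (@lebesgue_measure R).
Implicit Types a b c x : R.

(** One of the two factors exp (- x^2 / 2) of [gauss_fun x] absorbs the weight, since exp (x^2 / 2)
    >= 1 + x^2 / 2 and 2 + x^2 >= 1 + |x|. The weight [1 + |x|] covers all the factors that occur
    below: cosines, sines, and [x] times a sine. *)
Lemma gauss_fun_le (x : R) : (1 + `|x|) * gauss_fun x <= 2 * expR (- (x ^+ 2 / 2)).
Proof.
have -> : gauss_fun x = expR (- (x ^+ 2 / 2)) * expR (- (x ^+ 2 / 2)).
  by rewrite -expRD /gauss_fun; congr expR; field.
rewrite mulrA ler_wpM2r ?expR_ge0//.
rewrite expRN ler_pdivrMr ?expR_gt0//.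
have := expR_ge1Dx (x ^+ 2 / 2).
have := sqr_ge0 (`|x| - 1); rewrite -[in x ^+ 2 / 2]real_normK ?num_real//.
nra.
Qed.

Lemma is_derive_gauss x :
  is_derive x (1 : R) (@gauss_fun R) (- (2 * x) * gauss_fun x).
Proof.
rewrite mulrC; apply: (is_derive1_comp (f := expR) (g := fun x => - x ^+ 2)).
apply: is_derive_eq; rewrite /GRing.scale/=; ring.
Qed.

Lemma is_derive_sinM a x :
  is_derive x (1 : R) (fun y => sin (a * y)) (cos (a * x) * a).
Proof.
apply: (is_derive1_comp (f := sin) (g := fun x => a * x)).
by apply: is_derive_eq; rewrite /GRing.scale/= mulr1.
Qed.

Lemma is_derive_cosM a x :
  is_derive x (1 : R) (fun y => cos (a * y)) (- sin (a * x) * a).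
Proof.
apply: (is_derive1_comp (f := cos) (g := fun x => a * x)).
by apply: is_derive_eq; rewrite /GRing.scale/= mulr1.
Qed.

Let continuous_derive (f f' : R -> R) :
  (forall x : R, is_derive x (1 : R) f (f' x)) -> continuous f.
Proof.
by move=> df x; apply/differentiable_continuous/derivable1_diffP; apply: ex_derive.
Qed.

Lemma continuous_cosM a : continuous (fun x => cos (a * x)).
Proof. exact: (continuous_derive (is_derive_cosM a)). Qed.

Lemma continuous_sinM a : continuous (fun x => sin (a * x)).
Proof. exact: (continuous_derive (is_derive_sinM a)). Qed.

Lemma norm_mul_gauss_le (u : R) x : `|u| <= 1 + `|x| ->
  `|u * gauss_fun x| <= 2 * expR (- (x ^+ 2 / 2)).
Proof.
move=> u1; apply: le_trans (gauss_fun_le x).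
by rewrite normrM [X in _ * X]ger0_norm ?gauss_fun_ge0// ler_wpM2r ?gauss_fun_ge0.
Qed.

Lemma integrable_mul_gauss (u : R -> R) : continuous u ->
  (forall x, `|u x| <= 1 + `|x|) ->
  mu.-integrable setT (EFin \o (fun x => u x * gauss_fun x)).
Proof.
move=> cu u1; apply: (@integrable_gauss_dominated R 2) => [x|x].
  by apply: cvgM; [exact: cu|exact: continuous_gauss_fun].
exact: norm_mul_gauss_le.
Qed.

(** The Fourier transform [K] of the overview: the cosine suffices, as the sine part is zero by
    parity. *)
Definition gauss_cos b : R := \int[mu]_x (cos (b * x) * gauss_fun x).

Lemma integrable_gauss_cos b :
  mu.-integrable setT (EFin \o (fun x => cos (b * x) * gauss_fun x)).
Proof.
apply: integrable_mul_gauss; first exact: continuous_cosM.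
by move=> x; rewrite (le_trans (cos_max _))// lerDl.
Qed.

Lemma integrable_gauss_sin b :
  mu.-integrable setT (EFin \o (fun x => sin (b * x) * gauss_fun x)).
Proof.
apply: integrable_mul_gauss; first exact: continuous_sinM.
by move=> x; rewrite (le_trans (sin_max _))// lerDl.
Qed.

Lemma integrable_id_gauss_sin b :
  mu.-integrable setT (EFin \o (fun x => x * sin (b * x) * gauss_fun x)).
Proof.
apply: (@integrable_mul_gauss (fun x => x * sin (b * x))) => x.
  by apply: cvgM; [exact: cvg_id|exact: continuous_sinM].
rewrite normrM (@le_trans _ _ (`|x| * 1)) ?ler_wpM2l ?sin_max//.
by rewrite mulr1 lerDr.
Qed.

(** The integrand is odd, so reflection turns the integral into its opposite. *)
Lemma Rintegral_sin_gauss b : \int[mu]_x (sin (b * x) * gauss_fun x) = 0.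
Proof.
have := Rintegral_measure_preserving (@oppr_measurable _ _)
  (@lebesgue_measureN R) (integrable_gauss_sin b).
under eq_Rintegral => x _.
  have -> : sin (b * - x) * gauss_fun (- x) = - 1 * (sin (b * x) * gauss_fun x).
    by rewrite mulrN sinN /gauss_fun sqrrN; ring.
  over.
rewrite RintegralZl//; last exact: integrable_gauss_sin.
by set I := Rintegral _ _ _; lra.
Qed.

(** Assuming only [|y n| = n] treats the boundary terms at both ends of the line at once. *)
Lemma cvg_sin_gauss b (y : R ^nat) : (forall n, `|y n| = n%:R) ->
  sin (b * y n) * gauss_fun (y n) @[n --> \oo] --> (0 : R).
Proof.
move=> yn; apply: norm_cvg0.
have le n : cst 0 n <= `|sin (b * y n) * gauss_fun (y n)| <= gauss_fun (n%:R : R).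
  rewrite normr_ge0 normrM /= [X in _ * X]ger0_norm ?gauss_fun_ge0//.
  rewrite {2}/gauss_fun -yn real_normK ?num_real//.
  by rewrite ler_piMl ?gauss_fun_ge0// sin_max.
have gauss0 : gauss_fun (n%:R : R) @[n --> \oo] --> (0 : R).
  exact: (cvg_comp _ _ (@cvgr_idn R) cvg_gauss_fun).
have le' : \forall n \near \oo, cst 0 n <= `|sin (b * y n) * gauss_fun (y n)|
    <= gauss_fun (n%:R : R) by exact: nearW.
exact: (squeeze_cvgr le' (cvg_cst _) gauss0).
Qed.

(* The integrand is half of b cos (b x) exp (- x ^ 2) minus the derivative of
   sin (b x) exp (- x ^ 2), and that derivative has integral 0. *)
Lemma Rintegral_id_sin_gauss b :
  \int[mu]_x (x * sin (b * x) * gauss_fun x) = b / 2 * gauss_cos b.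
Proof.
pose f x := sin (b * x) * gauss_fun x.
pose f' x := b * (cos (b * x) * gauss_fun x) - 2 * (x * sin (b * x) * gauss_fun x).
have ic := integrableZl measurableT b (integrable_gauss_cos b).
have isg := integrableZl measurableT 2 (integrable_id_gauss_sin b).
have df x : is_derive x (1 : R) f (f' x).
  apply: is_derive_eq (is_deriveM (is_derive_sinM b x) (is_derive_gauss x)) _.
  by rewrite /GRing.scale/= /f'; ring.
have cf' : continuous f'.
  move=> x; apply: cvgB; apply: cvgM; try exact: cvg_cst.
    by apply: cvgM; [exact: continuous_cosM|exact: continuous_gauss_fun].
  apply: cvgM; last exact: continuous_gauss_fun.
  by apply: cvgM; [exact: cvg_id|exact: continuous_sinM].
have if' : mu.-integrable setT (EFin \o f').
  exact: (integrableB measurableT ic isg).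
have := Rintegral_derive_eq0 df cf' if'.
rewrite /f' RintegralB// RintegralZl//; last exact: integrable_gauss_cos.
rewrite RintegralZl//; last exact: integrable_id_gauss_sin.
rewrite -/(gauss_cos b); set I := Rintegral _ _ _ => h.
suff : b * gauss_cos b - 2 * I = 0 by lra.
by apply: h; apply: cvg_sin_gauss => n; rewrite ?normrN normr_nat.
Qed.

(** Differentiating under the integral brings down the factor - x sin (b x), whose integral against
    the Gaussian is known from [Rintegral_id_sin_gauss]. *)
Lemma is_derive_gauss_cos b :
  is_derive b (1 : R) gauss_cos (- (b / 2) * gauss_cos b).
Proof.
pose f b x := cos (b * x) * gauss_fun x.
have df c x : is_derive c (1 : R) (f ^~ x) (- (x * sin (c * x) * gauss_fun x)).
  have d : is_derive c (1 : R) (fun c => cos (c * x)) (- sin (c * x) * x).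
    have -> : (fun c => cos (c * x)) = (fun c => cos (x * c)).
      by apply/funext => y; rewrite mulrC.
    by rewrite [c * x]mulrC; exact: is_derive_cosM.
  apply: is_derive_eq (is_deriveM d (is_derive_cst (gauss_fun x) c 1)) _.
  by rewrite /GRing.scale/= mulr0 add0r; ring.
have pf c x : partial1of2 f c x = - (x * sin (c * x) * gauss_fun x).
  by rewrite partial1of2E; exact: derive_val.
(* The bound [G] below does not depend on the parameter, so any open interval around [b] would
   do. *)
have bI : `]b - 1, b + 1[%classic b by rewrite /= in_itv/=; lra.
pose G x : R := 2 * expR (- (x ^+ 2 / 2)).
have G0 x : 0 <= G x by rewrite mulr_ge0 ?expR_ge0.
have iG : mu.-integrable setT (EFin \o G).
  exact: (integrableZl measurableT 2 integrable_expR_half).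
have fi c : `]b - 1, b + 1[%classic c -> mu.-integrable setT (EFin \o f c).
  by move=> _; exact: integrable_gauss_cos.
have dfi c x : `]b - 1, b + 1[%classic c -> setT x -> derivable (f ^~ x) c 1.
  by move=> _ _; apply: ex_derive.
have Gf c x : `]b - 1, b + 1[%classic c -> setT x -> `|partial1of2 f c x| <= G x.
  move=> _ _; rewrite pf normrN; apply: norm_mul_gauss_le.
  rewrite normrM (@le_trans _ _ (`|x| * 1)) ?ler_wpM2l ?sin_max//.
  by rewrite mulr1 lerDr.
apply: DeriveDef.
  exact: (derivable_under_integral measurableT bI fi dfi G0 iG Gf).
rewrite -derive1E (differentiation_under_integral measurableT bI fi dfi G0 iG Gf).
under eq_Rintegral do rewrite pf -mulN1r.
rewrite RintegralZl//; last exact: integrable_id_gauss_sin.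
by rewrite Rintegral_id_sin_gauss mulN1r mulNr.
Qed.

(** By its differential equation, K b exp (b^2 / 4) has derivative 0, and its value at 0 is the
    Gaussian integral. *)
Lemma gauss_cosE b : gauss_cos b = Num.sqrt pi * expR (- (b ^+ 2 / 4)).
Proof.
have d0 (x : R) : is_derive x (1 : R) (fun b => gauss_cos b * expR (b ^+ 2 / 4)) 0.
  have de : is_derive x (1 : R) (fun b => expR (b ^+ 2 / 4))
      (expR (x ^+ 2 / 4) * (x / 2)).
    apply: (is_derive1_comp (f := expR) (g := fun x => x ^+ 2 / 4)).
    by apply: is_derive_eq; rewrite /GRing.scale/=; field.
  apply: is_derive_eq (is_deriveM (is_derive_gauss_cos x) de) _.
  by rewrite /GRing.scale/=; field.
have := is_derive_0_is_cst b 0 d0.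
rewrite expr0n/= mul0r expR0 mulr1 {2}/gauss_cos.
under eq_Rintegral do rewrite mul0r cos0 mul1r.
rewrite [RHS]/Rintegral integralT_gauss/= => <-.
by rewrite -mulrA -expRD subrr expR0 mulr1.
Qed.

End GaussFourier.

(** * Gaussian integrals with a translation and a phase *)

Section GaussPhase.
Context {R : realType}.
Local Notation mu := (@lebesgue_measure R).
Implicit Types a b c th x : R.

(** The addition formula takes the constant phase out of the integral; after translating back, the
    cosine term gives [gauss_cos b] and the sine term gives 0. *)
Lemma cos_gauss_shiftE b c th x :
  cos (b * (x - c) + th) * gauss_fun (x - c) =
  cos th * (cos (b * (x - c)) * gauss_fun (x - c)) -
  sin th * (sin (b * (x - c)) * gauss_fun (x - c)).
Proof. by rewrite cosD; ring. Qed.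

Lemma sin_gauss_shiftE b c th x :
  sin (b * (x - c) + th) * gauss_fun (x - c) =
  sin th * (cos (b * (x - c)) * gauss_fun (x - c)) +
  cos th * (sin (b * (x - c)) * gauss_fun (x - c)).
Proof. by rewrite sinD; ring. Qed.

Let integrable_shift (f : R -> R) c : mu.-integrable setT (EFin \o f) ->
  mu.-integrable setT (EFin \o (fun x => f (x - c))).
Proof.
move=> fi.
apply: (@integrable_measure_preserving _ (fun x => x - c)) => //.
  exact: measurable_funB.
exact: lebesgue_measure_shift.
Qed.

Let Rintegral_shift (f : R -> R) c : mu.-integrable setT (EFin \o f) ->
  \int[mu]_x f (x - c) = \int[mu]_x f x.
Proof.
move=> fi; apply: (@Rintegral_measure_preserving _ (fun x => x - c)) => //.
  exact: measurable_funB.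
exact: lebesgue_measure_shift.
Qed.

Let iC b c k : mu.-integrable setT
  (EFin \o (fun x => k * (cos (b * (x - c)) * gauss_fun (x - c)))).
Proof.
exact: (integrableZl measurableT k (integrable_shift c (integrable_gauss_cos b))).
Qed.

Let iS b c k : mu.-integrable setT
  (EFin \o (fun x => k * (sin (b * (x - c)) * gauss_fun (x - c)))).
Proof.
exact: (integrableZl measurableT k (integrable_shift c (integrable_gauss_sin b))).
Qed.

Lemma integrable_cos_gauss_shift b c th : mu.-integrable setT
  (EFin \o (fun x => cos (b * (x - c) + th) * gauss_fun (x - c))).
Proof.
have := integrableB measurableT (iC b c (cos th)) (iS b c (sin th)).
by apply: eq_integrable => // x _ /=; rewrite cos_gauss_shiftE EFinB.
Qed.

Lemma integrable_sin_gauss_shift b c th : mu.-integrable setT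
  (EFin \o (fun x => sin (b * (x - c) + th) * gauss_fun (x - c))).
Proof.
have := integrableD measurableT (iC b c (sin th)) (iS b c (cos th)).
by apply: eq_integrable => // x _ /=; rewrite sin_gauss_shiftE EFinD.
Qed.

Let RC b c k : \int[mu]_x (k * (cos (b * (x - c)) * gauss_fun (x - c))) =
  k * (Num.sqrt pi * expR (- (b ^+ 2 / 4))).
Proof.
have i := integrable_gauss_cos b.
rewrite RintegralZl//; last exact: (integrable_shift c i).
by rewrite (Rintegral_shift c i) -/(gauss_cos b) gauss_cosE.
Qed.

Let RS b c k : \int[mu]_x (k * (sin (b * (x - c)) * gauss_fun (x - c))) = 0.
Proof.
have i := integrable_gauss_sin b.
rewrite RintegralZl//; last exact: (integrable_shift c i).
by rewrite (Rintegral_shift c i) Rintegral_sin_gauss mulr0.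
Qed.

Lemma Rintegral_cos_gauss_shift b c th :
  \int[mu]_x (cos (b * (x - c) + th) * gauss_fun (x - c)) =
  Num.sqrt pi * expR (- (b ^+ 2 / 4)) * cos th.
Proof.
under eq_Rintegral do rewrite cos_gauss_shiftE.
by rewrite RintegralB ?RC ?RS ?subr0 1?mulrC.
Qed.

Lemma Rintegral_sin_gauss_shift b c th :
  \int[mu]_x (sin (b * (x - c) + th) * gauss_fun (x - c)) =
  Num.sqrt pi * expR (- (b ^+ 2 / 4)) * sin th.
Proof.
under eq_Rintegral do rewrite sin_gauss_shiftE.
by rewrite RintegralD ?RC ?RS ?addr0 1?mulrC.
Qed.

End GaussPhase.

Local Close Scope classical_set_scope.

(** * Closed form of the wavelet transform *)

Section CliffordPlane.
Variables (R : realType) (n : nat).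
Local Notation Cl := (clifford R n).
Implicit Types (j : 'I_n) (a b c d k th : R).

(** As e_j^2 = -1, this is complex multiplication. *)
Lemma cl_span1M j a b c d :
  (a%:A + b *: cl_gen R j) * (c%:A + d *: cl_gen R j) =
  (a * c - b * d)%:A + (a * d + b * c) *: cl_gen R j.
Proof.
rewrite mulrDl !mulrDr -!scalerAl !mul1r -!scalerAr !mulr1 cl_gen_sqr.
rewrite !scalerA scalerBl scalerDl scalerN.
by rewrite -!addrA; congr (_ + _); rewrite [RHS]addrC -addrA.
Qed.

Lemma cl_conj_expi j k th :
  cl_conj j (k *: cl_expi j th) = k *: cl_expi j (- th).
Proof.
by rewrite /cl_expi !scalerDr !scalerA cl_conjE cosN sinN mulrN scaleNr.
Qed.

Lemma cl_expi_coord j th (A : {set 'I_n}) :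
  cl_expi j th A = cos th * (A == finset.set0)%:R + sin th * (A == [set j])%:R.
Proof. by rewrite /cl_expi ffunE !cl_scaleE !ffunE. Qed.

End CliffordPlane.

Section Wavelet.
Variables (R : realType) (n : nat).
Local Notation G := (Gn R n).
Local Notation Cl := (clifford R n).
Implicit Types (g h : G) (j : 'I_n).

(** [E_j] of the overview, with [h] carrying the primed coordinates; [overlap_phase] is
    [Theta_j]. *)
Definition overlap_exponent g h j : R :=
  - ((pco h - pco g) ^+ 2 + (qco h j - qco g j) ^+ 2) / 2.

Definition overlap_phase g h j : R :=
  2 * (tco h j - tco g j) + (qco h j * pco g - qco g j * pco h).

Lemma coherentE g j x : coherent g j x =
  expR (- ((x - Num.sqrt 2 * pco g) ^+ 2 / 2)) *:
  cl_expi j (2 * tco g j + qco g j * (Num.sqrt 2 * x - pco g)).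
Proof. by rewrite /coherent /rho /vacuum -scalerAr mulr1. Qed.

(** With s = sqrt 2 and the midpoint c = s (p' + p) / 2, completing the square gives (x - s p')^2 /
    2 + (x - s p)^2 / 2 = (x - c)^2 + (p' - p)^2 / 2. Conjugation makes the phases subtract, and
    expanding their difference around c leaves the constant [overlap_phase]. *)
Lemma coherent_product h g j x :
  coherent h j x * cl_conj j (coherent g j x) =
  expR (- ((pco h - pco g) ^+ 2 / 2)) *:
  (gauss_fun (x - Num.sqrt 2 * (pco h + pco g) / 2) *:
   cl_expi j (Num.sqrt 2 * (qco h j - qco g j) *
      (x - Num.sqrt 2 * (pco h + pco g) / 2) + overlap_phase g h j)).
Proof.
have s2 : Num.sqrt 2 * Num.sqrt 2 = 2 :> R by rewrite -expr2 sqr_sqrtr.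
rewrite !coherentE cl_conj_expi -scalerAl -scalerAr scalerA -cl_expiD.
rewrite scalerA /gauss_fun -!expRD; congr (expR _ *: cl_expi _ _).
  move: s2; set s := Num.sqrt 2 => s2.
  have sq y : (x - s * y) ^+ 2 = x ^+ 2 - 2 * (s * x * y) + s * s * y ^+ 2.
    by ring.
  by rewrite -mulrA !sq s2; field.
rewrite /overlap_phase; move: s2; set s := Num.sqrt 2 => s2.
rewrite [in RHS]mulrBr (_ : s * _ * (s * _ / 2) =
  s * s / 2 * ((qco h j - qco g j) * (pco h + pco g))); last by field.
by rewrite s2; field.
Qed.

Lemma waveletE h g : wavelet (coherent h) g =
  \sum_j (Num.sqrt pi * expR (overlap_exponent g h j)) *:
    cl_expi j (overlap_phase g h j).
Proof.
apply/ffunP => A; rewrite /wavelet /cl_integral ffunE sum_ffunE.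
pose c := Num.sqrt 2 * (pco h + pco g) / 2.
pose b j := Num.sqrt 2 * (qco h j - qco g j).
pose E := expR (- ((pco h - pco g) ^+ 2 / 2)).
(* The cosine sits in the coordinate of the empty set and the sine in that of [[set j]]; for any
   other [A] both parts vanish. *)
pose u j x := E * (A == finset.set0)%:R *
  (cos (b j * (x - c) + overlap_phase g h j) * gauss_fun (x - c)).
pose v j x := E * (A == [set j])%:R *
  (sin (b j * (x - c) + overlap_phase g h j) * gauss_fun (x - c)).
have iu j : lebesgue_measure.-integrable setT (EFin \o u j).
  exact: (integrableZl measurableT _ (integrable_cos_gauss_shift _ _ _)).
have iv j : lebesgue_measure.-integrable setT (EFin \o v j).
  exact: (integrableZl measurableT _ (integrable_sin_gauss_shift _ _ _)).
under eq_Rintegral => x _.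
  rewrite sum_ffunE.
  under eq_bigr => j _.
    rewrite coherent_product !cl_scaleE cl_expi_coord -/c -/(b j) -/E.
    rewrite (_ : E * _ = u j x + v j x); last by rewrite /u /v; ring.
    over.
  over.
rewrite Rintegral_sum//; last first.
  by move=> j; exact: (integrableD measurableT (iu j) (iv j)).
apply: eq_bigr => j _; rewrite RintegralD// !RintegralZl//; first last.
- exact: integrable_cos_gauss_shift.
- exact: integrable_sin_gauss_shift.
rewrite Rintegral_cos_gauss_shift Rintegral_sin_gauss_shift.
rewrite cl_scaleE cl_expi_coord.
(* The Fourier transform at the frequency [b j] contributes - (b j)^2 / 4 = - (q'_j - q_j)^2 / 2,
   the part of the exponent not yet contained in [E]. *)
rewrite (_ : overlap_exponent g h j = - ((pco h - pco g) ^+ 2 / 2) - (b j) ^+ 2 / 4).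
  by rewrite expRD -/E; ring.
by rewrite /b exprMn sqr_sqrtr// /overlap_exponent; field.
Qed.

End Wavelet.

(** * Derivatives *)

Section Diff.
Variables (R : realType) (V : normedModType R).

(** The chain rule linking differentials on [V], needed for the group coordinates, with one-variable
    derivatives, known for exp, cos and sin. *)
Lemma is_diff_comp_real (x : V) (f : V -> R) (df : V -> R) (phi : R -> R) (a : R) :
  is_diff x f df -> is_derive (f x) (1 : R) phi a ->
  is_diff x (fun y => phi (f y)) (fun v => df v * a).
Proof.
move=> dfx dphi.
have dp : is_diff (f x) phi (fun h => h *: a).
  apply: DiffDef; first by apply/derivable1_diffP; apply: ex_derive.
  rewrite deriv1E; last by apply: ex_derive.
  by apply/funext => h; rewrite derive1E derive_val.
exact: (is_diff_comp dfx dp).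
Qed.

Lemma is_diff_sum (I : Type) (s : seq I) (x : V) (f df : I -> V -> R) :
  (forall i, is_diff x (f i) (df i)) ->
  is_diff x (fun y => \sum_(i <- s) f i y) (fun v => \sum_(i <- s) df i v).
Proof.
move=> dfx; elim: s => [|i s IH].
  under eq_fun do rewrite big_nil.
  under [X in is_diff _ _ X]eq_fun do rewrite big_nil.
  exact: is_diff_cst.
under eq_fun do rewrite big_cons.
under [X in is_diff _ _ X]eq_fun do rewrite big_cons.
exact: is_diffD.
Qed.

End Diff.

(** * The group coordinates as continuous linear functions *)

Section GroupCoordinates.
Variables (R : realType) (n : nat).
Local Notation G := (Gn R n).
Implicit Types (g h v : G) (j : 'I_n).

Let is_diff_linear (f : G -> R) g : linear f -> continuous f -> is_diff g f f.
Proof.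
move=> lf cf.
pose F : {linear G -> R} := HB.pack f (GRing.isLinear.Build _ _ _ _ f lf).
apply: DiffDef; first exact: (@linear_differentiable _ _ _ F).
exact: (@diff_lin _ _ _ F).
Qed.

Lemma is_diff_pco g : is_diff g (@pco R n) (@pco R n).
Proof.
apply: is_diff_linear => // x.
by apply: (cvg_comp _ _ (@cvg_fst _ _ _ _ _) (@cvg_snd _ _ _ _ _)).
Qed.

Lemma is_diff_qco g j : is_diff g (fun h => qco h j) (fun h => qco h j).
Proof.
apply: is_diff_linear => [a u v|x]; first by rewrite /qco /= !mxE.
apply: (@continuous_comp _ _ _ (fun x : G => x.2) (fun M : 'rV[R]_n => M ord0 j)).
  exact: cvg_snd.
exact: coord_continuous.
Qed.

Lemma is_diff_tco g j : is_diff g (fun h => tco h j) (fun h => tco h j).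
Proof.
apply: is_diff_linear => [a u v|x]; first by rewrite /tco /= !mxE.
apply: (@continuous_comp _ _ _ (fun x : G => x.1.1) (fun M : 'rV[R]_n => M ord0 j)).
  exact: (cvg_comp _ _ (@cvg_fst _ _ _ _ _) (@cvg_fst _ _ _ _ _)).
exact: coord_continuous.
Qed.

End GroupCoordinates.

(** Here [w] stands for the j-th summand, and the three elements of the plane multiplying it for its
    logarithmic derivatives along p, q_j and t_j. The two hypotheses are the real part and the e_j
    part of the total coefficient of [w]. *)
Lemma cl_span1_dirac (R : realType) (n : nat) (j : 'I_n)
    (a b c d e f p q : R) (w : clifford R n) :
  a + d + (q * e - p * f) / 2 = 0 -> b - c + (q * f + p * e) / 2 = 0 ->
  (a%:A + b *: cl_gen R j) * w - cl_gen R j * ((c%:A + d *: cl_gen R j) * w)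
  + 2^-1 *: ((p *: cl_gen R j + q%:A) * ((e%:A + f *: cl_gen R j) * w)) = 0.
Proof.
move=> h1 h2; set g := cl_gen R j.
have gM : g * (c%:A + d *: g) = (- d)%:A + c *: g.
  have := cl_span1M j 0 1 c d.
  by rewrite scale0r add0r scale1r !mul0r !mul1r !add0r.
have pM : (p *: g + q%:A) * (e%:A + f *: g) =
    (q * e - p * f)%:A + (q * f + p * e) *: g.
  by rewrite [p *: g + _]addrC cl_span1M.
rewrite !mulrA gM pM (scalerAl 2^-1) -mulrBl -mulrDl.
rewrite [X in X * w](_ : _ = 0) ?mul0r//.
transitivity ((a + d + (q * e - p * f) / 2)%:A + (b - c + (q * f + p * e) / 2) *: g).
  by apply/ffunP => A; rewrite !(cl_scaleE, ffunE); field.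
by rewrite h1 h2 !scale0r addr0.
Qed.

(** * The Dirac operator applied to the wavelet transform *)

Section WaveletDerivative.
Variables (R : realType) (n : nat).
Local Notation G := (Gn R n).
Local Notation Cl := (clifford R n).
Implicit Types (g h v : G) (j : 'I_n).

Definition doverlap_exponent g h v j : R :=
  (pco h - pco g) * pco v + (qco h j - qco g j) * qco v j.

(** The base point [g] is absent because [overlap_phase] is affine in it. *)
Definition doverlap_phase h v j : R :=
  - 2 * tco v j + (qco h j * pco v - qco v j * pco h).

Lemma is_diff_overlap_exponent g h j :
  is_diff g (fun g => overlap_exponent g h j) (fun v => doverlap_exponent g h v j).
Proof.
have dp : is_diff g (fun g => pco h - pco g) (fun v => - pco v).
  apply: is_diff_eq (is_diffB (is_diff_cst (pco h) g) (is_diff_pco g)) _.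
  by apply/funext => v /=; rewrite !fctE sub0r.
have dq : is_diff g (fun g => qco h j - qco g j) (fun v => - qco v j).
  apply: is_diff_eq (is_diffB (is_diff_cst (qco h j) g) (is_diff_qco g j)) _.
  by apply/funext => v /=; rewrite !fctE sub0r.
(* The index 1 of [is_diffX] stands for the exponent 2. *)
have := is_diffZ (- 2^-1) (is_diffD (is_diffX 1 dp) (is_diffX 1 dq)).
rewrite (_ : - 2^-1 *: _ = fun g => overlap_exponent g h j); last first.
  by apply/funext => x; rewrite !fctE /overlap_exponent /GRing.scale/=; field.
move/is_diff_eq; apply; apply/funext => v.
by rewrite !fctE /doverlap_exponent /GRing.scale/=; field.
Qed.

Lemma is_diff_overlap_phase g h j :
  is_diff g (fun g => overlap_phase g h j) (fun v => doverlap_phase h v j).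
Proof.
have dt := is_diffB (is_diff_cst (2 * tco h j) g) (is_diffZ 2 (is_diff_tco g j)).
have dqp := is_diffB (is_diffZ (pco h) (is_diff_qco g j))
  (is_diffZ (qco h j) (is_diff_pco g)).
have := is_diffB dt dqp.
rewrite (_ : _ - _ = fun g => overlap_phase g h j); last first.
  by apply/funext => x; rewrite !fctE /overlap_phase /GRing.scale/=; ring.
move/is_diff_eq; apply; apply/funext => v.
by rewrite !fctE /doverlap_phase /GRing.scale/= sub0r; ring.
Qed.

Definition wavelet_term g h j : Cl :=
  (Num.sqrt pi * expR (overlap_exponent g h j)) *: cl_expi j (overlap_phase g h j).

(** The differential of exp (E_j + e_j Theta_j) is the logarithmic derivative dE_j + e_j dTheta_j
    times the exponential. The factor is put on the left, where the coefficients of the Dirac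
    operator act. *)
Definition dwavelet_term g h v j : Cl :=
  ((doverlap_exponent g h v j)%:A + doverlap_phase h v j *: cl_gen R j) *
  wavelet_term g h j.

Lemma is_diff_wavelet_term g h j (A : {set 'I_n}) :
  is_diff g (fun g => wavelet_term g h j A) (fun v => dwavelet_term g h v j A).
Proof.
have de := is_diff_comp_real (is_diff_overlap_exponent g h j)
  (is_derive_expR (overlap_exponent g h j)).
have dc := is_diff_comp_real (is_diff_overlap_phase g h j)
  (is_derive_cos (overlap_phase g h j)).
have ds := is_diff_comp_real (is_diff_overlap_phase g h j)
  (is_derive_sin (overlap_phase g h j)).
have := is_diffM (is_diffZ (Num.sqrt pi) de)
  (is_diffD (is_diffZ ((A == finset.set0)%:R : R) dc)
            (is_diffZ ((A == finset.set1 j)%:R : R) ds)).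
rewrite (_ : _ * _ = fun g => wavelet_term g h j A); last first.
  apply/funext => x; rewrite !fctE /wavelet_term cl_scaleE cl_expi_coord.
  by rewrite /GRing.scale/=; ring.
move/is_diff_eq; apply; apply/funext => v.
rewrite !fctE /dwavelet_term /wavelet_term -scalerAr {1}/cl_expi cl_span1M.
rewrite cl_scaleE !(cl_scaleE, ffunE) /GRing.scale/=; ring.
Qed.

Lemma wavelet_sumE h : wavelet (coherent h) =
  fun g => \sum_j wavelet_term g h j.
Proof. by apply/funext => g; rewrite waveletE. Qed.

Lemma is_diff_wavelet h g (A : {set 'I_n}) :
  is_diff g (fun g => wavelet (coherent h) g A)
    (fun v => (\sum_j dwavelet_term g h v j) A).
Proof.
rewrite wavelet_sumE.
under eq_fun do rewrite sum_ffunE.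
under [X in is_diff _ _ X]eq_fun do rewrite sum_ffunE.
by apply: is_diff_sum => j; exact: is_diff_wavelet_term.
Qed.

Lemma cl_derive_wavelet h v g :
  cl_derive (wavelet (coherent h)) v g = \sum_j dwavelet_term g h v j.
Proof.
apply/ffunP => A; rewrite ffunE.
have d := is_diff_wavelet h g A.
by rewrite deriveE; [rewrite diff_val|exact: ex_diff].
Qed.

(** [E_j] and [Theta_j] involve only t_j, p and q_j, so each derivative along q_k or t_k retains a
    single summand. *)
Lemma dwavelet_term_dir_q g h j k : j != k -> dwavelet_term g h (dir_q R k) j = 0.
Proof.
move=> jk; rewrite /dwavelet_term /doverlap_exponent /doverlap_phase.
rewrite /tco /qco /pco /= !mxE eqxx (negbTE jk) /=.
by rewrite !(mulr0, mul0r, addr0, subr0, scale0r).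
Qed.

Lemma dwavelet_term_dir_t g h j k : j != k -> dwavelet_term g h (dir_t R k) j = 0.
Proof.
move=> jk; rewrite /dwavelet_term /doverlap_exponent /doverlap_phase.
rewrite /tco /qco /pco /= !mxE eqxx (negbTE jk) /=.
by rewrite !(mulr0, mul0r, addr0, subr0, scale0r).
Qed.

Lemma dirac_wavelet h g : Defs.dirac (wavelet (coherent h)) g = 0.
Proof.
have dq k : cl_derive (wavelet (coherent h)) (dir_q R k) g =
    dwavelet_term g h (dir_q R k) k.
  rewrite cl_derive_wavelet (bigD1 k)//= big1 ?addr0// => j jk.
  exact: dwavelet_term_dir_q.
have dt k : cl_derive (wavelet (coherent h)) (dir_t R k) g =
    dwavelet_term g h (dir_t R k) k.
  rewrite cl_derive_wavelet (bigD1 k)//= big1 ?addr0// => j jk.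
  exact: dwavelet_term_dir_t.
rewrite /Defs.dirac cl_derive_wavelet scaler_sumr -sumrB -big_split/=.
apply: big1 => j _; rewrite dq dt.
(* The logarithmic derivatives are (p' - p) + q'_j e_j along p, (q'_j - q_j) - p' e_j along q_j, and
   - 2 e_j along t_j. The two conditions become (p' - p) - p' + p = 0 and q'_j - (q'_j - q_j) - q_j
   = 0. *)
rewrite /dwavelet_term; apply: cl_span1_dirac.
  by rewrite /doverlap_exponent /doverlap_phase /tco /qco /pco /= !mxE !eqxx /=; field.
by rewrite /doverlap_exponent /doverlap_phase /tco /qco /pco /= !mxE !eqxx /=; field.
Qed.

End WaveletDerivative.

Theorem mainTheorem2 (R : realType) (n : nat) (n_ge1 : (1 <= n)%N)
    (g' : Gn R n) :
  monogenic (wavelet (coherent g')).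
Proof.
split=> g; last exact: dirac_wavelet.
by move=> A; have d := is_diff_wavelet g' g A; exact: ex_diff.
Qed.
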